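(* Let $k$ be a field and let $I\subset k[\mathbf{y}]=k[y_1,\ldots,y_n]$ be a monomial ideal with $\hat L\cong LCM(I)$. Then $$\operatorname{pd} k[\mathbf{y}]/I\le \min(\operatorname{width}\operatorname{mi}(L),\ \operatorname{height}\hat L),$$ where $\operatorname{pd}$ denotes projective dimension over $k[\mathbf{y}]$.
   Context: For a monomial ideal $I$ with minimal monomial generators $f_1,\ldots,f_r$, the lcm-lattice $LCM(I)$ is the set of least common multiples of all subsets of $\{f_1,\ldots,f_r\}$ (the empty subset giving $1$), ordered by divisibility; it is a finite atomic lattice. For a finite lattice $\hat L$ with minimum $\hat 0$ and maximum $\hat 1$, $L=\hat L\setminus\{\hat 0,\hat 1\}$ and $\operatorname{mi}(L)$ is the subposet of meet-irreducible elements of $L$, i.e. elements of $L$ covered by exactly one element of $\hat L$. The width of a finite poset is the cardinality of its largest antichain. The height (rank) of $\hat L$ is the maximum of $\#C-1$ over chains $C\subseteq\hat L$.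
   Formalization: The case where the lattice has exactly two elements (I principal, generated by a monomial other than 1) is excluded: there L and mi(L) are empty, so the width is 0, while pd k[y]/I = 1 and the stated bound fails. *)

(* Defs.v *)
From HB Require Import structures.
From mathcomp Require Import all_boot all_order all_algebra.
From mathcomp Require Import generic_quotient ring_quotient.
From mathcomp Require Import finmap.
From mathcomp.multinomials Require Import mpoly.

Set Implicit Arguments.
Unset Strict Implicit.
Unset Printing Implicit Defensive.

Import Order.TTheory GRing.Theory.

Local Open Scope ring_scope.

Section QuotientModule.
Local Open Scope quotient_scope.
Variables (R : pzRingType) (V : lmodType R) (S : submodClosed V).

(* submodClosed is shared with semimodules and so does not extend zmodClosed,
   which Quotient.quot requires. *)
Definition submod_mem (x : V) : bool := x \in S.

Lemma submod_mem_zmod_closed : zmod_closed submod_mem.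
Proof.
split=> [|x y Sx Sy]; first exact: (rpred0 S).
change (x - y \in S); apply: rpredD; first exact: Sx.
by rewrite -scaleN1r; apply: rpredZ; exact: Sy.
Qed.

HB.instance Definition _ :=
  GRing.isZmodClosed.Build V submod_mem submod_mem_zmod_closed.

Definition submod_zmod : zmodClosed V := GRing.ZmodClosed.clone V submod_mem _.

Local Notation Q := (Quotient.quot submod_zmod).

Definition quot_scale (a : R) : Q -> Q := fun x => \pi_Q (a *: repr x).

Lemma pi_scale a x : \pi_Q (a *: x) = quot_scale a (\pi_Q x).
Proof.
have E y z : (y - z \in S) = (y == z %[mod Q]).
  exact: (Quotient.idealrBE submod_zmod).
by apply/eqP; rewrite -E -scalerBr rpredZ // E reprK.
Qed.

Lemma quot_scaleA a b x : quot_scale a (quot_scale b x) = quot_scale (a * b) x.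
Proof.
by rewrite -[x]reprK -(pi_scale b (repr x)) -(pi_scale a) -pi_scale scalerA.
Qed.

Lemma quot_scale1 : left_id 1 quot_scale.
Proof. by move=> x; rewrite -[x]reprK -pi_scale scale1r. Qed.

Lemma quot_scaleDr : right_distributive quot_scale +%R.
Proof.
by move=> a x y; rewrite -[x]reprK -[y]reprK -raddfD -!pi_scale -raddfD scalerDr.
Qed.

Lemma quot_scaleDl x : {morph quot_scale^~ x : a b / a + b}.
Proof. by move=> a b; rewrite -[x]reprK -!pi_scale -raddfD scalerDl. Qed.

HB.instance Definition _ := GRing.Zmodule_isLmodule.Build R Q
  quot_scaleA quot_scale1 quot_scaleDr quot_scaleDl.

End QuotientModule.

Notation quotmod S := (Quotient.quot (submod_zmod S)).

Section ProjectiveDimension.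
Variable R : pzRingType.

Definition projective (P : lmodType R) : Prop :=
  forall (A B : lmodType R) (g : {linear A -> B}) (f : {linear P -> B}),
    (forall b, exists a, g a = b) ->
    exists h : {linear P -> A}, forall x, g (h x) = f x.

Definition projective_resolution (M : lmodType R) (P : nat -> lmodType R)
    (d : forall i, {linear P i.+1 -> P i}) (e : {linear P 0%N -> M}) : Prop :=
  [/\ forall i, projective (P i),
      forall m, exists x, e x = m,
      forall x, e x = 0 <-> exists y, d 0%N y = x
    & forall i x, d i x = 0 <-> exists y, d i.+1 y = x].

(* pd M <= l, where pd M is the infimum of the lengths of the projective
   resolutions of M (infinite if there is no finite one).  In particular
   the zero module satisfies this for every l. *)
Definition projdim_le (M : lmodType R) (l : nat) : Prop :=
  exists (P : nat -> lmodType R) (d : forall i, {linear P i.+1 -> P i})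
         (e : {linear P 0%N -> M}),
    projective_resolution d e /\ forall i, (l < i)%N -> forall x : P i, x = 0.

End ProjectiveDimension.

(* An ideal of R is a submodule of R^o; the unit ideal is allowed. *)
Section MonomialIdeals.
Variables (k : fieldType) (n : nat).
Implicit Types (I : submodClosed {mpoly k[n]}^o) (G : {fset 'X_{1..n}}).

Definition monomials_generate I G : Prop :=
  forall p : {mpoly k[n]},
    p \in I <-> exists c : 'X_{1..n} -> {mpoly k[n]},
                  p = \sum_(g <- G) c g * 'X_[g].

Definition minimal_monomial_generators I G : Prop :=
  monomials_generate I G /\ forall H, (H `<` G)%fset -> ~ monomials_generate I H.

End MonomialIdeals.

Definition lcm_lattice (n : nat) (G : {fset 'X_{1..n}}) : {fset 'X_{1..n}} :=
  [fset \big[@mlcm n/0%MM]_(m <- enum_fset A) m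
    | A : {fset 'X_{1..n}} in fpowerset G]%fset.

(* (_ <= _)%MM is divisibility; the canonical order (_ <= _)%O on monomials
   is degrevlex, and is not the one wanted here. *)
Definition lcm_lattice_iso (disp : Order.disp_t) (L : finTBLatticeType disp)
    (n : nat) (G : {fset 'X_{1..n}}) : Prop :=
  exists phi : L -> 'X_{1..n},
    (forall x y : L, (x <= y)%O = (phi x <= phi y)%MM) /\
    (forall m, m \in lcm_lattice G <-> exists x, phi x = m).

Section FinitePosets.
Variables (disp : Order.disp_t) (T : finPOrderType disp).
Implicit Types A B C : {set T}.

Definition covered_by (x y : T) : bool :=
  (x < y)%O && ~~ [exists z, (x < z)%O && (z < y)%O].

Definition antichain B : bool :=
  [forall x in B, forall y in B, (x <= y)%O ==> (x == y)].

Definition chain C : bool :=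
  [forall x in C, forall y in C, (x <= y)%O || (y <= x)%O].

Definition width A : nat :=
  (\max_(B : {set T} | (B \subset A) && antichain B) #|B|)%N.

Definition height : nat := (\max_(C : {set T} | chain C) #|C|.-1)%N.

End FinitePosets.

Arguments height {disp} T.

Section ProperPart.
Variables (disp : Order.disp_t) (L : finTBLatticeType disp).

Definition proper_part : {set L} := [set x | (x != \bot%O) && (x != \top%O)].

(* When L is the two-element chain, which is the lcm-lattice of a principal
   ideal, proper_part L is empty and width (mi L) = 0 although the projective
   dimension is 1; that case has to be excluded. *)
Definition mi : {set L} :=
  [set x in proper_part | #|[set y | covered_by x y]| == 1%N].

End ProperPart.

Arguments mi {disp} L.

(* Main.v *)
(* For a monomial ideal (s) and a monomial g there is an exact sequence
   0 -> S/((s) : g) -> S/(s) -> S/(g, s) -> 0, and (s) : g is generated by the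
   monomials lcm(h, g)/g with h in s. Hence pd S/(g, s) is at most the maximum
   of pd S/(s) and 1 + pd S/((s) : g), and it suffices to find an integer
   invariant of s that does not increase when a generator is dropped and
   decreases by one in the colon ideals.

   The height of the lcm-lattice has this property: multiplication by g sends
   a chain of lcms of the generators of (s) : g to a chain of lcms of g and s
   that starts above 1.

   For the width, Dilworth's theorem covers mi(L) by w = width mi(L) chains.
   Giving x in L as j-th exponent the number of elements of the j-th chain
   that are not above x sends joins to lcms, and it is injective because every
   element is a meet of meet-irreducibles, so L is realized by monomials in w
   variables. If the generators are adjoined in increasing order of one
   exponent, the colon ideals no longer involve that variable. *)

Require Import Defs.
From HB Require Import structures.
From mathcomp Require Import all_boot all_order all_algebra.
From mathcomp Require Import generic_quotient ring_quotient finmap zify.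
From mathcomp.multinomials Require Import mpoly.

Set Implicit Arguments.
Unset Strict Implicit.
Unset Printing Implicit Defensive.

Import Order.TTheory GRing.Theory.

(** * Projective dimension *)

Section Kernel.
Local Open Scope ring_scope.
Variables (R : pzRingType) (U V : lmodType R) (f : {linear U -> V}).

Definition ker_mem : {pred U} := fun x => f x == 0.

Lemma ker_submod_closed : submod_closed ker_mem.
Proof.
split=> [|a x y]; first by apply/eqP; rewrite linear0.
move=> /eqP fx /eqP fy; apply/eqP.
by rewrite linearP fx fy scaler0 addr0.
Qed.

HB.instance Definition _ := GRing.isSubmodClosed.Build R U ker_mem ker_submod_closed.

Record kernel := Kernel { ker_val :> U; _ : ker_val \in ker_mem }.

HB.instance Definition _ := [isSub for ker_val].
HB.instance Definition _ := [Choice of kernel by <:].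
HB.instance Definition _ := [SubChoice_isSubLmodule of kernel by <:].

Lemma kernel_exists : exists (K : lmodType R) (i : {linear K -> U}),
  injective i /\ forall x, f x = 0 <-> exists y, i y = x.
Proof.
exists kernel, (val : {linear kernel -> U}); split=> [|x]; first exact: val_inj.
split=> [/eqP fx|[[y /= /eqP fy] <-]]; last exact: fy.
by exists (Kernel (fx : x \in ker_mem)).
Qed.

End Kernel.

Section Linear.
Local Open Scope ring_scope.
Variable R : pzRingType.
Implicit Types U V W A B C M : lmodType R.

Lemma build_linear U V (f : U -> V) :
  (forall a x y, f (a *: x + y) = a *: f x + f y) ->
  exists g : {linear U -> V}, g =1 f.
Proof.
move=> lin_f; pose mf := GRing.isLinear.Build R U V *:%R f lin_f.
by pose g : {linear U -> V} := HB.pack f mf; exists g.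
Qed.

Lemma factor_mono U V W (i : {linear U -> V}) (f : {linear W -> V}) :
    injective i -> (forall x, exists y, i y = f x) ->
  exists g : {linear W -> U}, forall x, i (g x) = f x.
Proof.
move=> inj_i im_f.
have ex x : exists y, i y == f x by have [y <-] := im_f x; exists y.
have [h iE] : exists h, forall x, i (h x) = f x.
  by exists (fun x => xchoose (ex x)) => x; apply/eqP; exact: (xchooseP (ex x)).
have [a x y|g gE] := @build_linear W U h.
  by apply: inj_i; rewrite linearP !iE linearP.
by exists g => x; rewrite gE.
Qed.

(** A section of [e] need not be linear, but two preimages of a point differ by an element of the
    kernel of [e], which [f] kills. *)
Lemma factor_epi U V W (e : {linear U -> V}) (f : {linear U -> W}) :
    (forall y, exists x, e x = y) -> (forall x, e x = 0 -> f x = 0) ->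
  exists g : {linear V -> W}, forall x, g (e x) = f x.
Proof.
move=> sur_e ker_f.
have ex y : exists x, e x == y by have [x <-] := sur_e y; exists x.
have [s eE] : exists s, forall y, e (s y) = y.
  by exists (fun y => xchoose (ex y)) => y; apply/eqP; exact: (xchooseP (ex y)).
have fE x y : e x = e y -> f x = f y.
  by move=> exy; apply/eqP; rewrite -subr_eq0 -linearB ker_f ?linearB ?exy ?subrr.
have [a x y|g gE] := @build_linear V W (f \o s).
  by rewrite /= -linearP; apply: fE; rewrite linearP !eE.
by exists g => x; rewrite gE /=; apply: fE; rewrite eE.
Qed.

(** * Short exact sequences and projective modules *)

Definition short_exact U V W (i : {linear U -> V}) (p : {linear V -> W}) : Prop :=
  [/\ injective i, forall z, exists y, p y = z
    & forall y, p y = 0 <-> exists x, i x = y].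

Lemma inj_linear U V (f : {linear U -> V}) :
  (forall x, f x = 0 -> x = 0) -> injective f.
Proof.
move=> f0 x y fxy; apply/eqP; rewrite -subr_eq0; apply/eqP/f0.
by rewrite linearB fxy subrr.
Qed.

Lemma projective_free1 : projective (R^o : lmodType R).
Proof.
move=> A B g f sur_g; have [a ga] := sur_g (f 1).
have [b x y|h hE] := @build_linear R^o A (fun x => x *: a).
  by rewrite scalerDl -scalerA.
by exists h => x; rewrite hE linearZ /= ga -linearZ /= /GRing.scale /= mulr1.
Qed.

Lemma trivial_module_exists : exists Z : lmodType R, forall x : Z, x = 0.
Proof.
have [Z [i [inj_i im_i]]] := kernel_exists (idfun : {linear R^o -> R^o}).
by exists Z => x; apply: inj_i; rewrite linear0; apply/im_i; exists x.
Qed.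

Lemma projective_trivial U : (forall x : U, x = 0) -> projective U.
Proof.
move=> U0 A B g f sur_g; exists \0%R => x.
by rewrite linear0 (U0 x) linear0.
Qed.

(** Projectivity of [C] splits the sequence, so a lift can be built separately on the two
    summands. *)
Lemma projective_extension A B C (i : {linear A -> B}) (p : {linear B -> C}) :
  short_exact i p -> projective A -> projective C -> projective B.
Proof.
move=> [inj_i sur_p ex_ip] prA prC X Y g f sur_g.
have [s ps] := prC _ _ p (idfun : {linear C -> C}) sur_p.
have [r ir] : exists r : {linear B -> A}, forall b, i (r b) = b - s (p b).
  have [//|b|r] := @factor_mono A B B i (idfun \- (s \o p)).
    by apply/ex_ip; rewrite linearB ps subrr.
  by exists r.
have [hA hAE] := prA _ _ g (f \o i) sur_g.
have [hC hCE] := prC _ _ g (f \o s) sur_g.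
exists ((hA \o r) \+ (hC \o p)) => b /=.
by rewrite linearD hAE hCE /= ir -linearD subrK.
Qed.

Lemma projective_bij U V (e : {linear U -> V}) :
  injective e -> (forall y, exists x, e x = y) -> projective U -> projective V.
Proof.
move=> inj_e sur_e prU A B g f sur_g.
have [|r er] := @factor_mono U V V e idfun inj_e; first exact: sur_e.
have [h hE] := prU _ _ g (f \o e) sur_g.
by exists (h \o r) => y; rewrite /= hE /= er.
Qed.

Lemma short_exact_pair U V :
  exists (i : {linear U -> (U * V)%type}) (p : {linear (U * V)%type -> V}),
    [/\ short_exact i p, forall x, i x = (x, 0) & forall z, p z = z.2].
Proof.
have [a x y|i iE] := @build_linear U (U * V)%type (fun x => (x, 0)).
  by congr pair => /=; rewrite scaler0 addr0.
have [//|p pE] := @build_linear (U * V)%type V snd.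
exists i, p; split=> //; split=> [x y|z|y]; first by rewrite !iE => -[].
  by exists (0, z); rewrite pE.
rewrite pE; split=> [|[x <-]]; last by rewrite iE.
by case: y => x y /= ->; exists x; rewrite iE.
Qed.

(** Recursion on syzygies: this form suits induction on [l] and is turned into an actual resolution
    by [pd_le_projdim_le]. *)
Fixpoint pd_le (l : nat) (M : lmodType R) : Prop :=
  if l is l'.+1 then
    exists (P K : lmodType R) (i : {linear K -> P}) (e : {linear P -> M}),
      [/\ projective P, short_exact i e & pd_le l' K]
  else projective M.

Lemma pd_le_trivial l U : (forall x : U, x = 0) -> pd_le l U.
Proof.
elim: l U => [|l IHl] U U0 /=; first exact: projective_trivial.
exists U, U, \0%R, (idfun : {linear U -> U}); split; last exact: IHl.
  exact: projective_trivial.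
have allU x y : x = y :> U by rewrite (U0 x) (U0 y).
by split=> [x y _|z|y]; [exact: allU | exists z | split=> _; [exists 0 |]; exact: allU].
Qed.

Lemma pd_leS l M : pd_le l M -> pd_le l.+1 M.
Proof.
elim: l M => [|l IHl] M /=.
  have [Z Z0] := trivial_module_exists; move=> prM.
  exists M, Z, \0%R, (idfun : {linear M -> M}).
  split=> //; last exact: projective_trivial.
  split=> [x y _|z|y]; [by rewrite (Z0 x) (Z0 y) | by exists z |].
  by split=> [y0|[x <-]] //; exists 0; exact: esym y0.
by move=> [P [K [i [e [prP ex pdK]]]]]; exists P, K, i, e; split=> //; exact: IHl.
Qed.

Lemma pd_le_projective l M : projective M -> pd_le l M.
Proof. by move=> prM; elim: l => // l; exact: pd_leS. Qed.

(** Horseshoe lemma: [PA * PC] covers [B], and the kernels of the three covers again form a short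
    exact sequence. *)
Lemma pd_le_extension l A B C (i : {linear A -> B}) (p : {linear B -> C}) :
  short_exact i p -> pd_le l A -> pd_le l C -> pd_le l B.
Proof.
elim: l A B C i p => [|l IHl] A B C i p ex_ip; first exact: (projective_extension ex_ip).
move=> [PA [KA [iA [eA [prA exA pdA]]]]] [PC [KC [iC [eC [prC exC pdC]]]]].
have [inj_i sur_p im_i] := ex_ip.
have [[injA surA imA] [injC surC imC]] := (exA, exC).
have [t tE] := prC _ _ p eC sur_p.
have [a [x1 x2] [y1 y2]|e eE] :=
    @build_linear (PA * PC)%type B (fun z => i (eA z.1) + t z.2).
  by rewrite /= !linearP !scalerDr addrACA.
have sur_e b : exists z, e z = b.
  have [x2 eCx2] := surC (p b).
  have [|a ia] := (im_i (b - t x2)).1; first by rewrite linearB tE eCx2 subrr.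
  by have [x1 eAx1] := surA a; exists (x1, x2); rewrite eE /= eAx1 ia subrK.
have pe z : p (e z) = eC z.2.
  by rewrite eE linearD tE (_ : p (i _) = 0) ?add0r //; apply/im_i; exists (eA z.1).
have [K [k [inj_k im_k]]] := kernel_exists e.
exists (PA * PC)%type, K, k, e; split=> //.
- have [j [q [ex_jq _ _]]] := short_exact_pair PA PC.
  exact: projective_extension ex_jq prA prC.
have [j [q [[inj_j sur_q im_j] jE qE]]] := short_exact_pair PA PC.
have [x|u uE] := @factor_mono _ _ _ k (j \o iA) inj_k.
  apply/im_k; rewrite eE /= jE /= !linear0 addr0.
  by rewrite (_ : eA _ = 0) ?linear0 //; apply/imA; exists x.
have [x|v vE] := @factor_mono _ _ _ iC (q \o k) injC.
  by apply/imC; rewrite /= qE -pe (_ : e _ = 0) ?linear0 //; apply/im_k; exists x.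
apply: (IHl _ _ _ u v) => //; split.
- by move=> x y /(congr1 k); rewrite !uE => /inj_j/injA.
(* [v] is onto: [t (iC z)] comes from [A], and [x1] is chosen to cancel it, which puts [(x1, iC z)]
   in the kernel of [e]. *)
- move=> z.
  have [a ia] : exists a, i a = t (iC z).
    by apply/im_i; rewrite tE; apply/imC; exists z.
  have [x1 eAx1] := surA (- a).
  have [|w wE] := (im_k (x1, iC z)).1.
    by rewrite eE /= eAx1 linearN ia addNr.
  by exists w; apply: injC; rewrite vE /= wE qE.
move=> w; have ew : e (k w) = 0 by apply/im_k; exists w.
split=> [vw|[x <-]]; last first.
  apply: injC; rewrite vE /= uE /= linear0; apply/im_j; by exists (iA x).
have [x1 x1E] : exists x1, j x1 = k w.
  by apply/im_j; have := vE w; rewrite vw linear0 /= => <-.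
have [x xE] : exists x, iA x = x1.
  apply/imA; apply: inj_i; rewrite linear0.
  by move: ew; rewrite -x1E eE jE /= linear0 addr0.
by exists x; apply: inj_k; rewrite uE /= xE.
Qed.

(** If [P] covers [B] with kernel [K], it also covers [C], and the new kernel is an extension of [A]
    by [K]. *)
Lemma pd_le_cokernel l A B C (i : {linear A -> B}) (p : {linear B -> C}) :
  short_exact i p -> pd_le l A -> pd_le l.+1 B -> pd_le l.+1 C.
Proof.
move=> [inj_i sur_p im_i] pdA [P [K [j [e [prP [inj_j sur_e im_j] pdK]]]]].
have sur_pe z : exists x, (p \o e) x = z.
  by have [y <-] := sur_p z; have [x <-] := sur_e y; exists x.
have [K' [k [inj_k im_k]]] := kernel_exists (p \o e).
exists P, K', k, (p \o e); split=> //.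
have pek x : p (e (k x)) = 0 by apply/im_k; exists x.
have ej x : e (j x) = 0 by apply/im_j; exists x.
have [x|u uE] := @factor_mono _ _ _ k j inj_k.
  by apply/im_k; rewrite /= ej linear0.
have [x|v vE] := @factor_mono _ _ _ i (e \o k) inj_i.
  by apply/im_i; rewrite /= pek.
apply: (pd_le_extension (i := u) (p := v)) => //; split.
- by move=> x y /(congr1 k); rewrite !uE => /inj_j.
- move=> a; have [y ey] := sur_e (i a).
  have [|x xE] := (im_k y).1.
    by rewrite /= ey; apply/im_i; exists a.
  by exists x; apply: inj_i; rewrite vE /= xE.
move=> x; split=> [vx|[y <-]]; last by apply: inj_i; rewrite vE /= uE ej linear0.
have [y jy] : exists y, j y = k x.
  by apply/im_j; have := vE x; rewrite vx linear0.
by exists y; apply: inj_k; rewrite uE.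
Qed.

Lemma pd_le_projdim_le l M : pd_le l M -> projdim_le M l.
Proof.
elim: l M => [|l IHl] M.
  move=> prM; have [Z Z0] := trivial_module_exists.
  exists (fun i => if i is 0 then M else Z), (fun i => \0%R), idfun.
  split; last by case.
  split=> [[|i]|m|x|i x] //; first exact: projective_trivial.
  - by exists m.
  - by split=> [x0|[y <-]] //; exists 0; exact: esym x0.
  - split=> // _; exists 0.
    by case: i x => [|i] x; rewrite (Z0 x).
move=> [P [K [i [e [prP [inj_i sur_e im_i] /IHl]]]]].
move=> [Q [d [f [[prQ sur_f im_f im_d] Q0]]]].
(* The resolution of [K], shifted by one place, is spliced to [P] along [i \o f]. *)
pose P' n := if n is n'.+1 then Q n' else P.
pose d' n : {linear P' n.+1 -> P' n} :=
  match n return {linear P' n.+1 -> P' n} with 0 => (i \o f) | n'.+1 => d n' end.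
exists P', d', e; split; last by case=> // n; exact: Q0.
split=> [[]|//|x|[|n] x] //=.
- split=> [/im_i[y <-]|[y <-]]; first by have [z <-] := sur_f y; exists z.
  by apply/im_i; exists (f y).
- rewrite -im_f; split=> [ifx|->]; last by rewrite linear0.
  by apply: inj_i; rewrite ifx linear0.
- exact: im_d.
Qed.

End Linear.

(** * Quotients by monomial ideals *)

Section QuotientProjection.
Local Open Scope ring_scope.
Variables (R : pzRingType) (V : lmodType R) (S : submodClosed V).

Lemma quotmod_proj : exists e : {linear V -> quotmod S},
  (forall y, exists x, e x = y) /\ (forall x, e x = 0 <-> x \in S).
Proof.
have [a x y|e eE] := @build_linear R V (quotmod S) \pi%qT.
  by rewrite raddfD /= pi_scale.
exists e; split=> [y|x]; first by exists (repr y); rewrite eE reprK.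
have := Quotient.idealrBE (submod_zmod S) x 0; rewrite subr0 eE => ->.
by rewrite -[0 in X in X <-> _](raddf0 \pi_(quotmod S)%qT); split=> /eqP.
Qed.

End QuotientProjection.

Lemma le0mn n (m : 'X_{1..n}) : (0 <= m)%MM.
Proof. by apply/mnm_lepP => i; rewrite mnm0E. Qed.
#[local] Hint Resolve le0mn : core.

Section MonomialIdeal.
Local Open Scope ring_scope.
Variables (k : fieldType) (n : nat).
Implicit Types (s G : seq 'X_{1..n}) (g m : 'X_{1..n}) (p q : {mpoly k[n]}).
Local Notation S := {mpoly k[n]}.

Definition divisible s m : bool := has (fun g => (g <= m)%MM) s.

(** Membership is a test on the support, hence boolean; [mideal_sum] identifies it with the span of
    the generators. *)
Definition mideal s : {pred S^o} := fun p : S => all (divisible s) (msupp p).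

Lemma midealP s p :
  reflect {in msupp p, forall m, divisible s m} (p \in mideal s).
Proof. exact: allP. Qed.

Lemma divisible_le s m m' : divisible s m -> (m <= m')%MM -> divisible s m'.
Proof. by move=> /hasP[g gs gm] mm'; apply/hasP; exists g; rewrite ?(lepm_trans gm). Qed.

Lemma mideal_submod_closed s : submod_closed (mideal s).
Proof.
split=> [|a x y]; first by apply/midealP => m; rewrite msupp0.
move=> /midealP xs /midealP ys; apply/midealP => m /msuppD_le.
rewrite mem_cat => /orP[/msuppM_le/allpairsP[[m1 m2] [_ /= m2x ->]]|/ys//].
exact: divisible_le (xs _ m2x) (lem_addl _ _).
Qed.

HB.instance Definition _ s :=
  GRing.isSubmodClosed.Build S S^o (mideal s) (mideal_submod_closed s).

Lemma midealX s m : ('X_[m] \in mideal s) = divisible s m.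
Proof.
apply/midealP/idP=> [|ms m']; rewrite msuppX; first by apply; rewrite inE.
by rewrite inE => /eqP->.
Qed.

Lemma mideal_eqi s s' : s =i s' -> mideal s =i mideal s'.
Proof. by move=> ss' p; apply: eq_all => m; exact: eq_has_r. Qed.

Lemma mideal_unit s p : 0%MM \in s -> p \in mideal s.
Proof. by move=> s0; apply/midealP => m _; apply/hasP; exists 0%MM. Qed.

(** Subtraction of exponents is truncated, so [(h - g)%MM] is the monomial lcm(h, g)/g. *)
Definition colon g s := [seq (h - g)%MM | h <- s].

Lemma mem_midealMX g s p : (p * 'X_[g] \in mideal s) = (p \in mideal (colon g s)).
Proof.
have E m : divisible s (g + m)%MM = divisible (colon g s) m.
  rewrite /divisible has_map; apply: eq_has => h /=.
  by apply/mnm_lepP/mnm_lepP => hm i; have := hm i; rewrite mnmDE mnmBE leq_subLR.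
apply/midealP/midealP => ps m mp.
  by rewrite -E; apply: ps; rewrite (perm_mem (msuppMX _ _)) map_f.
by move: mp; rewrite (perm_mem (msuppMX _ _)) => /mapP[m' /ps m'p ->]; rewrite E.
Qed.

Lemma mideal_cons g s p :
  p \in mideal (g :: s) <-> exists q, p - q * 'X_[g] \in mideal s.
Proof.
split=> [/midealP ps|[q /midealP qs]].
  (* The witness collects the terms of [p] that [g] divides, each divided by [g]. *)
  exists (\sum_(m <- msupp p | (g <= m)%MM) p@_m *: 'X_[m - g]).
  rewrite [X in X - _]mpolyE (bigID (fun m => (g <= m)%MM)) /= addrAC mulr_suml.
  rewrite (eq_bigr (fun m => (p@_m *: 'X_[m - g]) * 'X_[g])); last first.
    by move=> m gm; rewrite -scalerAl -mpolyXD submK.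
  rewrite subrr add0r big_seq_cond; apply: (@rpred_sum S^o (mideal s)) => m /andP[mp gm].
  rewrite -mul_mpolyC; apply: (rpredZ (p@_m)%:MP); rewrite midealX.
  by have := ps m mp; rewrite /divisible /= (negPf gm).
apply/midealP => m mp; rewrite /divisible /=; case: (boolP (g <= m)%MM) => //= gm.
apply: qs; rewrite mcoeff_msupp mcoeffB (_ : (_ * _)@_m = 0) ?subr0 -?mcoeff_msupp //.
apply: memN_msupp_eq0; rewrite (perm_mem (msuppMX _ _)).
by apply: contra gm => /mapP[m' _ ->]; exact: lem_addr.
Qed.

Lemma mideal_sum s p : uniq s ->
  p \in mideal s <-> exists c : 'X_{1..n} -> S, p = \sum_(g <- s) c g * 'X_[g].
Proof.
move=> uniq_s; split=> [|[c ->]]; last first.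
  rewrite big_seq; apply: (@rpred_sum S^o (mideal s)) => g gs.
  apply: (rpredZ (c g)); rewrite midealX; apply/hasP; exists g => //.
  exact: lepm_refl.
elim: s uniq_s p => [_ p /midealP p0|g s IHs /= /andP[gNs /IHs{}IHs] p].
  exists (fun=> 0); rewrite big_nil; apply: msuppnil0.
  by case: msupp p0 => // m t /(_ m (mem_head _ _)).
move=> /mideal_cons[q /IHs[c pE]].
exists (fun h => if h == g then q else c h); rewrite big_cons eqxx.
rewrite -[LHS](subrK (q * 'X_[g])) addrC pE; congr (_ + _).
by apply: eq_big_seq => h hs; case: eqP gNs => // <-; rewrite hs.
Qed.

Lemma monomials_generateE (I : submodClosed S^o) (G : {fset 'X_{1..n}}) :
  monomials_generate I G <-> I =i mideal G.
Proof.
split=> IG p; last by rewrite IG; apply: mideal_sum; exact: fset_uniq.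
by apply/idP/idP => [/IG|] /(mideal_sum _ (fset_uniq G)) // /IG.
Qed.

(** Describes S/(s) up to isomorphism, so that quotients by equal ideals never have to be
    identified. *)
Definition presents s (M : lmodType S) : Prop :=
  exists e : {linear S^o -> M},
    (forall y, exists x, e x = y) /\ (forall x, e x = 0 <-> x \in mideal s).

Lemma presents_quotmod (I : submodClosed S^o) s :
  I =i mideal s -> presents s (quotmod I).
Proof.
move=> Is; have [e [sur_e e0]] := quotmod_proj I; exists e; split=> // x.
by rewrite e0 Is.
Qed.

(** Multiplication by [g] induces [i], injective by the definition of the colon ideal; the inclusion
    of (s) in (g, s) induces [p]. *)
Lemma presents_cons g s (A B C : lmodType S) :
    presents (colon g s) A -> presents s B -> presents (g :: s) C ->
  exists (i : {linear A -> B}) (p : {linear B -> C}), short_exact i p.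
Proof.
move=> [eA [surA eA0]] [eB [surB eB0]] [eC [surC eC0]].
have [a x y|mu muE] := @build_linear S S^o S^o (fun p : S => p * 'X_[g]).
  by rewrite mulrDl /GRing.scale /= mulrA.
have [//|x|i iE] := factor_epi (e := eA) (f := eB \o mu).
  by rewrite eA0 /= eB0 muE mem_midealMX.
have [//|x /eB0 xs|p pE] := factor_epi (e := eB) (f := eC).
  by apply/eC0/mideal_cons; exists 0; rewrite mul0r subr0.
exists i, p; split=> [|z|y].
- apply: inj_linear => y; have [x <-] := surA y.
  by rewrite iE /= eB0 muE mem_midealMX eA0.
- by have [x <-] := surC z; exists (eB x).
have [x <-] := surB y; rewrite pE eC0 mideal_cons; split=> [[q]|[a]].
  move=> /eB0/eqP; rewrite linearB subr_eq0 => /eqP ->.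
  by exists (eA q); rewrite iE /= muE.
have [q <-] := surA a; rewrite iE /= muE => eBq; exists q.
by apply/eB0; rewrite linearB /= eBq subrr.
Qed.

(* The recursion follows the exact sequences
   0 -> S/((s) : g) -> S/(s) -> S/(g, s) -> 0. *)
Inductive colon_rank : nat -> seq 'X_{1..n} -> Prop :=
| colon_rank_unit l s : 0%MM \in s -> colon_rank l s
| colon_rank_nil l : colon_rank l [::]
| colon_rank_cons l g s :
    colon_rank l.+1 s -> colon_rank l (colon g s) -> colon_rank l.+1 (g :: s)
| colon_rank_eqi l s s' : s =i s' -> colon_rank l s -> colon_rank l s'.

(** The unit ideal gives the zero module, the empty list the free module of rank one, and
    [pd_le_cokernel] handles an added generator. *)
Lemma colon_rank_pd l s :
  colon_rank l s -> forall M : lmodType S, presents s M -> pd_le l M.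
Proof.
elim=> {l s} [l s s0|l|l g s _ IHs _ IHg|l s s' ss' _ IHs] M.
- move=> [e [sur_e e0]]; apply: pd_le_trivial => y; have [x <-] := sur_e y.
  by apply/e0; exact: mideal_unit.
- move=> [e [sur_e e0]]; apply: pd_le_projective.
  have e00 x : e x = 0 -> x = 0.
    move/e0 => /midealP x0; apply: msuppnil0.
    by case: msupp x0 => // m t /(_ m (mem_head _ _)).
  apply: (projective_bij (e := e)) => //; first exact: inj_linear.
  exact: projective_free1.
- move=> prM.
  pose mid t := GRing.SubmodClosed.clone _ _ (mideal t) _.
  have prA := @presents_quotmod (mid (colon g s)) _ (fun=> erefl).
  have prB := @presents_quotmod (mid s) _ (fun=> erefl).
  have [i [p ex_ip]] := presents_cons prA prB prM.
  exact: pd_le_cokernel ex_ip (IHg _ prA) (IHs _ prB).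
- move=> [e [sur_e e0]]; apply: IHs; exists e; split=> // x.
  by rewrite e0 -(mideal_eqi ss').
Qed.
End MonomialIdeal.

(** * Lcms of generators and colon ideals *)

Section Lcm.
Variable n : nat.
Implicit Types (s A : seq 'X_{1..n}) (g m : 'X_{1..n}).

Definition lcms s := \big[@mlcm n/0%MM]_(m <- s) m.

Lemma lem_lcms s m : (lcms s <= m)%MM = all (fun g => (g <= m)%MM) s.
Proof.
elim: s => [|g s IHs]; rewrite /lcms ?big_nil ?big_cons /=.
  exact: le0mn.
by rewrite lem_mlcm; congr (_ && _).
Qed.

Lemma lem_anti m m' : (m <= m')%MM -> (m' <= m)%MM -> m = m'.
Proof.
move=> /mnm_lepP mm' /mnm_lepP m'm; apply/mnmP => i; apply/anti_leq.
by rewrite mm' m'm.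
Qed.

Lemma lcms_eqi s s' : s =i s' -> lcms s = lcms s'.
Proof.
move=> ss'; apply: lem_anti; rewrite lem_lcms.
  by rewrite (eq_all_r ss') -lem_lcms lepm_refl.
by rewrite -(eq_all_r ss') -lem_lcms lepm_refl.
Qed.

Lemma lcms_cons g s : lcms (g :: s) = mlcm g (lcms s).
Proof. exact: big_cons. Qed.

Lemma lcms_colon g s : lcms (colon g s) = (lcms s - g)%MM.
Proof.
elim: s => [|m s IHs].
  by rewrite /lcms !big_nil; apply/mnmP => i; rewrite mnmBE mnm0E.
by rewrite /= !lcms_cons IHs; apply/mnmP => i; rewrite /mlcm !mnmE; lia.
Qed.

(* The e j x are exponents, in l new variables, of monomials whose lcms still
   control the lcms of the m x. If the generators are adjoined by increasing
   exponent in the last variable, that variable disappears from the colon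
   ideals; sequences being built from the right, the order is decreasing. *)
Lemma colon_rank_width l (T : eqType) (m : T -> 'X_{1..n}) (e : nat -> T -> nat)
    (s : seq T) :
    (forall x (A : seq T), x \in s -> {subset A <= s} ->
       (forall j, (j < l)%N -> (e j x <= \max_(a <- A) e j a)%N) ->
       (m x <= lcms (map m A))%MM) ->
  colon_rank l (map m s).
Proof.
elim: l m e s => [|l IHl] m e s ms.
  (* With no exponents left, the hypothesis applies to the empty [A]: every [m x] is 1, and a
     nonempty list generates the unit ideal. *)
  case: s ms => [|x s] ms; first exact: colon_rank_nil.
  apply: colon_rank_unit; rewrite /= (_ : m x = 0%MM) ?inE ?eqxx //.
  have := ms x [::] (mem_head _ _); rewrite /= /lcms big_nil => m0.
  by apply: lem_anti; [exact: m0 | exact: le0mn].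
pose r x y := (e l y <= e l x)%N.
apply: (@colon_rank_eqi _ _ (map m (sort r s))).
  by apply: eq_mem_map => x; rewrite mem_sort.
have : sorted r (sort r s) by apply: sort_sorted => x y; exact: leq_total.
have {}ms x (A : seq T) : x \in sort r s -> {subset A <= sort r s} ->
    (forall j, (j < l.+1)%N -> (e j x <= \max_(a <- A) e j a)%N) ->
    (m x <= lcms (map m A))%MM.
  by rewrite mem_sort => xs As; apply: ms => // a /As; rewrite mem_sort.
elim: (sort r s) ms => [|x t IHt] mt sort_t /=; first exact: colon_rank_nil.
apply: colon_rank_cons.
  apply: IHt; last exact: path_sorted sort_t.
  move=> y A yt At; apply: mt => [|a /At]; rewrite inE ?yt ?orbT // => ->.
  by rewrite orbT.
have colon_map (A : seq T) : colon (m x) (map m A) = [seq (m y - m x)%MM | y <- A].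
  by rewrite /colon -map_comp.
rewrite colon_map.
(* The new exponents undergo the same truncated subtraction as the monomials. *)
apply: (IHl _ (fun j y => e j y - e j x)%N) => y A yt At le_yA.
rewrite -colon_map lcms_colon.
(* The element [x] is added to [A]: it comes first in decreasing order, so it alone bounds the
   exponent of index [l]. For the others, undo the truncated subtraction. *)
have : (m y <= lcms (map m (x :: A)))%MM.
  apply: mt => [|a|j]; rewrite ?inE ?yt ?orbT //.
    by case/orP=> [->//|/At->]; rewrite orbT.
  rewrite ltnS leq_eqVlt big_cons leq_max => /predU1P[->|jl].
    have : transitive r by move=> a b c /= ba cb; exact: leq_trans cb ba.
    by move=> /order_path_min/(_ sort_t)/allP/(_ y yt); rewrite /r => ->.
  have := le_yA j jl.
  have -> : (\max_(a <- A) (e j a - e j x) = \max_(a <- A) e j a - e j x)%N.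
    by elim: (A) => [|a A' IHA]; rewrite ?big_nil ?big_cons // IHA; lia.
  by lia.
rewrite /= lcms_cons => /mnm_lepP yA; apply/mnm_lepP => i.
by have := yA i; rewrite /mlcm !mnmE; lia.
Qed.

Definition strict_dvd m m' : bool := (m <= m')%MM && (m != m').

(** [c] lists the elements of a chain, so [l.+1] elements mean length [l]. *)
Lemma colon_rank_height l s :
    (forall c, {in c, forall u, exists2 A, {subset A <= s} & u = lcms A} ->
       sorted strict_dvd c -> (size c <= l.+1)%N) ->
  colon_rank l s.
Proof.
have lcms0 : lcms [::] = 0%MM by exact: big_nil.
elim: l s => [|l IHl] s cs.
  case: s cs => [|g s] cs; first exact: colon_rank_nil.
  (* A generator [g] other than 1 would give the two-element chain 1, [g]. *)
  apply: colon_rank_unit; case: (eqVneq g 0%MM) => [->|g0]; first exact: mem_head.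
  suff: (2 <= 1)%N by [].
  apply: (cs [:: 0%MM; g]); last by rewrite /= /strict_dvd le0mn eq_sym g0.
  move=> u; rewrite !inE => /orP[] /eqP->; first by exists [::].
  exists [:: g]; last by rewrite lcms_cons lcms0 mlcm0.
  by move=> h; rewrite !inE => ->.
elim: s cs => [|g s IHs] cs; first exact: colon_rank_nil.
have [->|g0] := eqVneq g 0%MM; first by apply: colon_rank_unit; exact: mem_head.
apply: colon_rank_cons.
  apply: IHs => c cA; apply: cs => u /cA[A As uA]; exists A => // h /As hs.
  by rewrite inE hs orbT.
apply: IHl => c cA c_sorted; rewrite -ltnS.
(* Multiplying by [g] and prepending 1 turns a chain for the colon ideal into one for [g :: s] with
   one more element. *)
have := cs (0%MM :: [seq (u + g)%MM | u <- c]); rewrite /= size_map; apply.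
  move=> u; rewrite inE => /predU1P[->|/mapP[v /cA[A As ->] ->]]; first by exists [::].
  (* [A'] pulls [A] back to generators in [s], so that lcm(g, A') is [g] times lcm(A). *)
  pose A' := [seq h <- s | (h - g)%MM \in A].
  exists (g :: A').
    by move=> h; rewrite !inE mem_filter => /predU1P[->|/andP[_ ->]]; rewrite ?eqxx ?orbT.
  rewrite lcms_cons mlcmE addmC -lcms_colon; congr (_ + _)%MM; apply: lcms_eqi => v'.
  apply/idP/mapP => [v'A|[h]]; last by rewrite mem_filter => /andP[hA _ ->].
  have /mapP[h hs v'E] := As _ v'A; exists h => //.
  by rewrite mem_filter hs -v'E v'A.
case: c c_sorted {cA} => //= u c uc; apply/andP; split.
  by rewrite /strict_dvd le0mn eq_sym mnmD_eq0 negb_and g0 orbT.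
apply: homo_path uc => v v' /andP[vv' v_neq]; apply/andP; split.
  by apply/mnm_lepP => i; rewrite !mnmDE leq_add2r; exact: (mnm_lepP vv').
by apply: contraNneq v_neq => /(can_inj (addmK g))->.
Qed.

End Lcm.

(** * Dilworth's theorem *)

Section Dilworth.
Variables (disp : Order.disp_t) (T : finPOrderType disp).
Implicit Types (A B D : {set T}) (a x y z : T).

Lemma antichainP B : reflect {in B &, forall x y, (x <= y)%O -> x = y} (antichain B).
Proof.
apply: (iffP forall_inP) => [aB x y xB yB xy|aB x xB].
  by have /forall_inP/(_ y yB)/implyP/(_ xy)/eqP := aB x xB.
by apply/forall_inP => y yB; apply/implyP => xy; apply/eqP; exact: aB.
Qed.

Lemma card_antichain_le_width A B : B \subset A -> antichain B -> (#|B| <= width A)%N.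
Proof. by move=> BA aB; apply: (@leq_bigmax_cond _ _ (fun B => #|B|)); rewrite BA. Qed.

Lemma width_attained A : exists B, [/\ B \subset A, antichain B & #|B| = width A].
Proof.
have : (0 < #|[pred B : {set T} | (B \subset A) && antichain B]|)%N.
  apply/card_gt0P; exists set0; rewrite inE sub0set; apply/antichainP => x y.
  by rewrite inE.
case/(eq_bigmax_cond (fun B : {set T} => #|B|)) => B; rewrite inE => /andP[BA aB].
by move=> wE; exists B.
Qed.

Lemma width_subset A B : A \subset B -> (width A <= width B)%N.
Proof.
move=> AB; have [D [DA aD <-]] := width_attained A.
exact: card_antichain_le_width (subset_trans DA AB) aD.
Qed.

(** Choose an element of [D] whose down-set is largest; a strictly greater one would have a larger
    down-set. *)
Lemma maximal_exists D x :
  x \in D -> exists2 y, y \in D & {in D, forall z, (y <= z)%O -> z = y}.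
Proof.
move=> xD; pose down z := [set t | (t <= z)%O].
case: (arg_maxnP (fun z => #|down z|) xD) => y yD max_y; exists y => // z zD yz.
have sub_yz : down y \subset down z.
  by apply/subsetP => t; rewrite !inE => /le_trans; apply.
have /eqP eq_yz : down y == down z by rewrite eqEcard sub_yz; exact: max_y.
have : z \in down z by rewrite inE.
by rewrite -eq_yz inE => zy; apply/le_anti; rewrite zy.
Qed.

(** A cover of [A] by chains, recorded as a colouring; the values outside [A] are arbitrary. *)
Definition chain_coloring A (f : T -> nat) : Prop :=
  {in A, forall x, (f x < width A)%N} /\
  {in A &, forall x y, f x = f y -> (x <= y)%O || (y <= x)%O}.

(** Pigeonhole: an antichain has at most one point of each colour, and here it has as many points as
    there are colours. *)
Lemma coloring_meets A f B i : chain_coloring A f ->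
    B \subset A -> antichain B -> #|B| = width A -> (i < width A)%N ->
  exists2 x, x \in B & f x = i.
Proof.
move=> [f_lt f_chain] /subsetP BA /antichainP aB cardB i_lt.
have uniq_f : uniq (map f (enum B)).
  rewrite map_inj_in_uniq ?enum_uniq // => x y; rewrite !mem_enum => xB yB fxy.
  have /orP[/aB|/aB H] := f_chain x y (BA x xB) (BA y yB) fxy; first exact.
  by rewrite H.
have sub_f : {subset map f (enum B) <= iota 0 (width A)}.
  move=> j /mapP[x]; rewrite mem_enum => xB ->; rewrite mem_iota add0n /=.
  exact: f_lt (BA _ xB).
have [|_ fE] := uniq_min_size uniq_f sub_f.
  by rewrite size_iota size_map -cardE cardB.
have : i \in map f (enum B) by rewrite fE mem_iota.
by case/mapP=> x; rewrite mem_enum => xB ->; exists x.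
Qed.

(* Galvin's proof. Remove a maximal element a and colour the rest with chains.
   On each chain take the greatest point lying in a maximum antichain; these
   points form an antichain X. Either a is incomparable to X and needs a new
   colour, or a lies above some x of X, and removing the chain formed by a and
   the points of the colour of x below x lowers the width. *)
Theorem dilworth A : exists f, chain_coloring A f.
Proof.
have [m] := ubnP #|A|; elim: m => // m IHm in A *.
have [->|[a0 a0A]] := set_0Vmem A; first by exists (fun=> 0%N); split=> x; rewrite inE.
rewrite ltnS => card_A; have [a aA max_a] := maximal_exists a0A.
pose A' := A :\ a.
have sA'A : A' \subset A := subD1set A a.
have card_A' : (#|A'| < m)%N by rewrite (leq_trans _ card_A) // (cardsD1 a A) aA.
have [f fA'] := IHm A' card_A'; have [f_lt f_chain] := fA'.
pose in_max x := [exists B : {set T},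
  [&& B \subset A', antichain B, #|B| == width A' & x \in B]].
have in_maxP x : reflect (exists B : {set T},
    [/\ B \subset A', antichain B, #|B| = width A' & x \in B]) (in_max x).
  apply: (iffP existsP) => -[B].
    by move=> /and4P[? ? /eqP ? ?]; exists B.
  by case=> ? ? /eqP ? ?; exists B; apply/and4P.
have in_maxA' x : in_max x -> x \in A' by case/in_maxP=> B [/subsetP BA' _ _ /BA'].
pose X := [set x in A' |
  in_max x & [forall y, (in_max y && (f y == f x)) ==> (y <= x)%O]].
have X_max x y : x \in X -> in_max y -> f y = f x -> (y <= x)%O.
  rewrite !inE => /and3P[_ _ /forallP/(_ y)/implyP le_yx] my fyx; apply: le_yx.
  by rewrite my fyx eqxx.
have XA' : X \subset A' by apply/subsetP => x; rewrite inE => /andP[].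
have Xin x : x \in X -> in_max x by rewrite inE => /and3P[].
(* If x <= y in [X], a maximum antichain through y has a point z of the colour of x. Then z <= x <=
   y forces z = y, hence y <= x. *)
have aX : antichain X.
  apply/antichainP => x y xX yX xy.
  have /in_maxP[B [BA' aB cB yB]] := Xin y yX.
  have [z zB fz] := coloring_meets fA' BA' aB cB (f_lt x (in_maxA' _ (Xin _ xX))).
  have mz : in_max z by apply/in_maxP; exists B.
  have zx : (z <= x)%O by exact: X_max.
  have zy : z = y by move/antichainP: aB; apply=> //; exact: le_trans xy.
  by apply/le_anti; rewrite xy X_max //; [exact: Xin | rewrite -zy].
have X_color i : (i < width A')%N -> exists2 x, x \in X & f x = i.
  move=> i_lt; have [B [BA' aB cB]] := width_attained A'.
  have [z zB fz] := coloring_meets fA' BA' aB cB i_lt.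
  have : z \in [set x | in_max x && (f x == i)].
    by rewrite inE fz eqxx andbT; apply/in_maxP; exists B.
  case/maximal_exists=> x; rewrite inE => /andP[mx /eqP fx] max_x; exists x => //.
  rewrite inE mx (in_maxA' _ mx); apply/forallP => y; apply/implyP => /andP[my /eqP fyx].
  have /orP[//|xy] := f_chain y x (in_maxA' _ my) (in_maxA' _ mx) fyx.
  by rewrite (max_x y) // inE my fyx fx eqxx.
have card_X : (width A' <= #|X|)%N.
  rewrite -[leqLHS](size_iota 0) cardE -(size_map f); apply: uniq_leq_size.
    exact: iota_uniq.
  move=> i; rewrite mem_iota add0n /= => /X_color[x xX <-].
  by apply: map_f; rewrite mem_enum.
have [/existsP[x /andP[xX xa]]|no_x] := boolP [exists x, (x \in X) && (x <= a)%O].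
  have mx := Xin _ xX; have xA' := in_maxA' _ mx.
  pose K := a |: [set z in A' | (f z == f x) && (z <= x)%O].
  pose D := A :\: K.
  have sDA' : D \subset A'.
    by apply/subsetP => z; rewrite !inE negb_or => /andP[/andP[-> _] ->].
  have [h [h_lt h_chain]] : exists h, chain_coloring D h.
    by apply: IHm; exact: leq_ltn_trans (subset_leq_card sDA') card_A'.
  (* An antichain of size [width A'] inside [D] would have a point of the colour of [x]; it lies
     below [x], hence in [K], a contradiction. *)
  have wD : (width D < width A')%N.
    have [B [BD aB cB]] := width_attained D.
    rewrite ltn_neqAle width_subset // andbT; apply/eqP => wE.
    have BA' := subset_trans BD sDA'; rewrite wE in cB.
    have [z zB fz] := coloring_meets fA' BA' aB cB (f_lt x xA').
    have zx : (z <= x)%O by apply: X_max => //; apply/in_maxP; exists B.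
    have := subsetP BD z zB; have := subsetP BA' z zB.
    by rewrite !inE => /andP[za zA]; rewrite (negPf za) zA fz zx eqxx.
  have wA : (width D < width A)%N := leq_trans wD (width_subset sA'A).
  have inK z : z \in K -> (z == a) || [&& z \in A', f z == f x & (z <= x)%O].
    by rewrite !inE.
  have inD z : z \in A -> z \notin K -> z \in D by move=> zA zK; rewrite inE zK.
  (* The colour [width D] is free, since [h] takes smaller values on [D]. *)
  exists (fun z => if z \in K then width D else h z); split=> [z zA|y z yA zA].
    by case: ifPn => // zK; exact: ltn_trans (h_lt z (inD _ zA zK)) wA.
  case: ifPn => yK; case: ifPn => zK; last 1 first.
  - by apply: h_chain; exact: inD.
  - move=> _; case/orP: (inK _ yK) => [/eqP->|/and3P[yA' /eqP fy yx]].
      case/orP: (inK _ zK) => [/eqP->|/and3P[_ _ zx]]; first by rewrite lexx.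
      by rewrite (le_trans zx xa) orbT.
    case/orP: (inK _ zK) => [/eqP->|/and3P[zA' /eqP fz _]].
      by rewrite (le_trans yx xa).
    by apply: f_chain; rewrite ?fy.
  - by move=> wE; have := h_lt z (inD _ zA zK); rewrite -wE ltnn.
  - by move=> wE; have := h_lt y (inD _ yA yK); rewrite wE ltnn.
have aNX : a \notin X by apply: contraTN isT => /(subsetP XA'); rewrite !inE eqxx.
have aaX : antichain (a |: X).
  have aN x : x \in X -> (x <= a)%O = false.
    by move=> xX; apply: contraNF no_x => xa; apply/existsP; exists x; rewrite xX.
  apply/antichainP => x y; rewrite !(in_setU1 _ a).
  move=> /predU1P[->|xX] /predU1P[->|yX] //.
  - by move=> ay; rewrite (max_a y) // (subsetP sA'A) ?(subsetP XA').
  - by rewrite aN.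
  - by move/antichainP: aX; apply.
(* Adding [a] to [X] raises the width, which makes room for [width A'] as a new colour. *)
have wA : (width A' < width A)%N.
  apply: (@leq_trans #|a |: X|); first by rewrite cardsU1 aNX add1n ltnS.
  apply: card_antichain_le_width => //; rewrite subUset sub1set aA.
  exact: subset_trans sA'A.
have inA' z : z \in A -> z != a -> z \in A' by move=> zA za; rewrite !inE za.
exists (fun z => if z == a then width A' else f z); split=> [z zA|y z yA zA].
  by case: eqP => // /eqP za; exact: ltn_trans (f_lt _ (inA' _ zA za)) wA.
case: eqP => [->|/eqP ya]; case: eqP => [->|/eqP za].
- by rewrite lexx.
- by move=> wE; have := f_lt z (inA' _ zA za); rewrite -wE ltnn.
- by move=> wE; have := f_lt y (inA' _ yA ya); rewrite wE ltnn.
- by apply: f_chain; exact: inA'.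
Qed.

End Dilworth.

(** * Lcm-lattices *)

(** Lists may replace finite sets because an lcm ignores order and repetition. *)
Lemma lcm_latticeP n (G : {fset 'X_{1..n}}) m :
  reflect (exists2 A : seq 'X_{1..n}, {subset A <= G} & m = lcms A) (m \in lcm_lattice G).
Proof.
apply: (iffP (imfsetP _ _ _ _)) => [[A /=]|[A AG ->]].
  by rewrite fpowersetE => /fsubsetP AG ->; exists (enum_fset A).
exists [fset g in A]%fset => /=.
  by rewrite fpowersetE; apply/fsubsetP => g; rewrite inE; exact: AG.
by rewrite -/(lcms _); apply: lcms_eqi => g; rewrite inE.
Qed.

(** A generator divisible by another one could be dropped without changing the ideal. *)
Lemma minimal_generators_antichain (k : fieldType) n
    (I : submodClosed ({mpoly k[n]}^o)%type) (G : {fset 'X_{1..n}}) :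
  minimal_monomial_generators I G -> {in G &, forall g h, (g <= h)%MM -> g = h}.
Proof.
move=> [/monomials_generateE genI minI] g h gG hG gh; apply/eqP/negPn/negP => g_neq_h.
apply: (minI _ (fproperD1 hG)); apply/monomials_generateE => p; rewrite genI.
apply: eq_all => m; apply/hasP/hasP => -[f fG fm].
  have [fh|f_neq_h] := eqVneq f h; last by exists f => //; rewrite !inE f_neq_h.
  by exists g; [rewrite !inE g_neq_h | rewrite (lepm_trans gh) // -fh].
by exists f => //; move: fG; rewrite !inE => /andP[].
Qed.

Section LcmLattice.
Variables (n : nat) (G : {fset 'X_{1..n}}).
Variables (disp : Order.disp_t) (L : finTBLatticeType disp) (phi : L -> 'X_{1..n}).
Hypothesis phi_le : forall x y : L, (x <= y)%O = (phi x <= phi y)%MM.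
Hypothesis phi_im : forall m, m \in lcm_lattice G <-> exists x, phi x = m.

Lemma phi_inj : injective phi.
Proof. by move=> x y xy; apply/le_anti; rewrite !phi_le xy lepm_refl. Qed.

Lemma phi_lcms (A : seq 'X_{1..n}) : {subset A <= G} -> exists x, phi x = lcms A.
Proof. by move=> AG; apply/phi_im/lcm_latticeP; exists A. Qed.

Lemma phi_generator g : g \in G -> exists x, phi x = g.
Proof.
move=> gG; have [|x xE] := @phi_lcms [:: g]; first by move=> h; rewrite inE => /eqP->.
by exists x; rewrite xE lcms_cons /lcms big_nil mlcm0.
Qed.

(** Chains of lcms are pulled back along [phi] to chains of [L]. *)
Lemma colon_rank_lattice_height : colon_rank (height L) G.
Proof.
apply: colon_rank_height => c cA c_sorted.
have [xs xsE] : exists xs, c = map phi xs.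
  elim: c cA {c_sorted} => [|u c IHc] cA; first by exists [::].
  have [v vc|xs ->] := IHc; first by apply: cA; rewrite inE vc orbT.
  have [A AG uA] := cA u (mem_head _ _).
  by have [x xu] := phi_lcms AG; exists (x :: xs); rewrite /= xu uA.
have xs_sorted : sorted <%O xs.
  move: c_sorted; rewrite xsE sorted_map; apply: sub_sorted => x y /=.
  move=> /andP[xy neq_xy]; rewrite lt_neqAle phi_le xy andbT.
  by apply: contraNneq neq_xy => ->.
rewrite xsE size_map -(card_uniqP (lt_sorted_uniq xs_sorted)).
pose C : {set L} := [set x in xs].
have cC : chain C.
  apply/forall_inP => x; rewrite inE => xxs; apply/forall_inP => y; rewrite inE => yxs.
  have xs_le : sorted <=%O xs by apply: sub_sorted xs_sorted => a b; exact: ltW.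
  have le_xs := sorted_leq_index le_trans le_refl xs_le.
  by case/orP: (leq_total (index x xs) (index y xs)) => /le_xs -> //; rewrite orbT.
have <- : #|C| = #|xs| by rewrite cardsE.
rewrite (leq_trans (leqSpred _)) // ltnS.
exact: (@leq_bigmax_cond _ _ (fun C : {set L} => #|C|.-1)).
Qed.

(** * Separation by meet-irreducible elements *)

Hypothesis G_antichain : {in G &, forall g h, (g <= h)%MM -> g = h}.

Lemma phi_bot : phi \bot%O = 0%MM.
Proof.
have [|x x0] := @phi_lcms [::]; first by [].
apply: lem_anti; last exact: le0mn.
by have := le0x x; rewrite phi_le x0 /lcms big_nil.
Qed.

(** A least nonzero [x] is a generator dividing all generators other than 1, so by the antichain
    property it is the only one. This rules out the bottom as a separating element. *)
Lemma card_lattice_bot_irreducible (x : L) :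
  x != \bot%O -> (forall z, z != \bot%O -> (x <= z)%O) -> #|L| = 2.
Proof.
move=> x_neq0 le_x.
have G_ge g : g \in G -> g != 0%MM -> (phi x <= g)%MM.
  move=> /phi_generator[w <-] w0; rewrite -phi_le le_x //.
  by apply: contraNneq w0 => ->; rewrite phi_bot.
(* [phi x] is an lcm of generators; any of them other than 1 divides it and is divisible by it. *)
have xG : phi x \in G.
  have /lcm_latticeP[B BG xB] : phi x \in lcm_lattice G by apply/phi_im; exists x.
  have [/hasP[b bB b0]|] := boolP (has (fun b => b != 0%MM) B).
    suff -> : phi x = b by exact: BG.
    apply: lem_anti; first by apply: G_ge => //; exact: BG.
    have := lepm_refl (phi x); rewrite {1}xB lem_lcms => /allP; exact.
  rewrite -all_predC => /allP B0; case/eqP: x_neq0; apply: phi_inj.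
  rewrite phi_bot; apply: lem_anti; last exact: le0mn.
  by rewrite xB lem_lcms; apply/allP => b /B0 /= /negPn/eqP->; exact: lepm_refl.
have zE z : (z == \bot%O) || (z == x).
  have [//|z0] := eqVneq z \bot%O; apply/eqP/le_anti; rewrite le_x // andbT phi_le.
  have /lcm_latticeP[A AG ->] : phi z \in lcm_lattice G by apply/phi_im; exists z.
  rewrite lem_lcms; apply/allP => a /AG aG.
  have [->|a0] := eqVneq a 0%MM; first exact: le0mn.
  by rewrite -(G_antichain xG aG) ?lepm_refl ?G_ge.
rewrite -cardsT (_ : [set: L] = [set \bot%O; x]); first by rewrite cards2 eq_sym x_neq0.
by apply/setP => z; rewrite !inE zE.
Qed.

Hypothesis L_neq2 : #|L| <> 2.

(** Take [c] maximal among the elements above [y] but not above [x]. Everything strictly above [c]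
    is above [x], so the join of [c] and [x] is the only cover of [c]. *)
Lemma mi_separates (x y : L) :
  ~~ (x <= y)%O -> exists2 c, c \in mi L & (y <= c)%O && ~~ (x <= c)%O.
Proof.
move=> xy; have : y \in [set z | (y <= z)%O && ~~ (x <= z)%O] by rewrite inE lexx.
case/maximal_exists=> c; rewrite inE => yxc max_c; exists c => //.
case/andP: yxc => yc xc.
have c_lt z : (c < z)%O -> (x <= z)%O.
  move=> cz; apply/negPn/negP => xz; move: (cz); rewrite lt_neqAle => /andP[+ c_le].
  by rewrite eq_sym (max_c z) ?eqxx // inE xz (le_trans yc).
rewrite /mi !inE; apply/andP; split.
  apply/andP; split; last by apply: contraNneq xc => ->; exact: lex1.
  (* If [c] were the bottom, [x] would be the least nonzero element. *)
  apply/eqP => c0; apply: L_neq2; apply: (@card_lattice_bot_irreducible x).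
    by apply: contraNneq xc => ->; exact: le0x.
  by move=> z z0; apply: c_lt; rewrite c0 lt0x.
apply/cards1P; exists (Order.join c x); apply/setP => z; rewrite !inE /covered_by.
have c_lt_join : (c < Order.join c x)%O.
  by rewrite lt_neqAle leUl andbT; apply: contraNneq xc => ->; exact: leUr.
apply/andP/eqP => [[cz /existsPn no_between]|->].
  have jz : (Order.join c x <= z)%O by rewrite leUx (ltW cz) c_lt.
  apply/eqP; apply: contraT => z_neq; have := no_between (Order.join c x).
  by rewrite c_lt_join lt_neqAle jz eq_sym z_neq.
split=> //; apply/existsPn => w; apply/negP => /andP[cw w_lt].
have : (Order.join c x <= w)%O by rewrite leUx (ltW cw) c_lt.
by move=> /le_lt_trans/(_ w_lt); rewrite ltxx.
Qed.

Lemma colon_rank_lattice_width : colon_rank (width (mi L)) G.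
Proof.
have [f [f_lt f_chain]] := dilworth (mi L).
pose s := [seq x <- enum L | phi x \in G].
apply: (@colon_rank_eqi _ _ (map phi s)).
  move=> g; apply/mapP/idP => [[x]|gG]; first by rewrite mem_filter => /andP[xG _] ->.
  by have [w wE] := phi_generator gG; exists w; rewrite // mem_filter mem_enum wE gG.
(* x |-> #|avoid j x| turns joins into maxima, because c >= x \/ y iff c >= x
   and c >= y, and because f^-1(j) is a chain. *)
pose avoid j x := [set c in mi L | (f c == j) && ~~ (x <= c)%O].
have in_avoid j x d : (d \in avoid j x) = [&& d \in mi L, f d == j & ~~ (x <= d)%O].
  by rewrite in_set.
apply: (colon_rank_width (e := fun j x => #|avoid j x|)) => x A xs As le_xA.
have [|z zA] := @phi_lcms (map phi A).
  by move=> g /mapP[a /As]; rewrite mem_filter => /andP[aG _] ->.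
(* [z] is the join of [A]. If [x] is not below [z], a separating [c] makes the exponent of [x] in
   the chain of [c] exceed those of all elements of [A]. *)
rewrite -zA -phi_le; apply: contraT => /mi_separates[c cmi /andP[zc xc]].
have /allP a_le : all (fun g => (g <= phi z)%MM) (map phi A).
  by rewrite -lem_lcms zA lepm_refl.
have := le_xA (f c) (f_lt c cmi); rewrite leqNgt => /negP; case.
have lt_x a : a \in A -> (#|avoid (f c) a| < #|avoid (f c) x|)%N.
  move=> aA; have ac : (a <= c)%O by rewrite (le_trans _ zc) // phi_le a_le ?map_f.
  apply: proper_card; apply/properP; split; last first.
    by exists c; rewrite in_avoid cmi eqxx ?ac.
  (* If x <= d, comparability of [c] and [d] forces c <= d, because [x] is not below [c]; then a <=
     c <= d. *)
  apply/subsetP => d; rewrite !in_avoid => /and3P[dmi /eqP fd ad].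
  rewrite dmi fd eqxx /=; apply: contra ad => xd.
  have /orP[dc|cd] := f_chain d c dmi cmi fd; last exact: le_trans cd.
  by rewrite (le_trans xd dc) in xc.
(* An empty maximum is 0, so for empty [A] the point [c] itself shows that the exponent of [x] is
   positive. *)
elim: (A) lt_x => [|a A' IHA] lt_x.
  by rewrite big_nil; apply/card_gt0P; exists c; rewrite in_avoid cmi eqxx.
rewrite big_cons gtn_max lt_x ?mem_head //=; apply: IHA => b bA'.
by apply: lt_x; rewrite inE bA' orbT.
Qed.

End LcmLattice.

Theorem theorem4p4 (k : fieldType) (n : nat)
    (I : submodClosed ({mpoly k[n]}^o)%type) (G : {fset 'X_{1..n}})
    (disp : Order.disp_t) (L : finTBLatticeType disp)
    (minG : minimal_monomial_generators I G)
    (isoL : lcm_lattice_iso L G)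
    (L_neq2 : #|L| <> 2) :
  projdim_le (quotmod I) (minn (width (mi L)) (height L)).
Proof.
have [phi [phi_le phi_im]] := isoL.
have presI : presents G (quotmod I).
  by apply: presents_quotmod; apply/monomials_generateE; case: minG.
apply/pd_le_projdim_le/(colon_rank_pd _ presI); rewrite /minn; case: ifP => _.
  exact: colon_rank_lattice_width phi_im (minimal_generators_antichain minG) L_neq2.
exact: colon_rank_lattice_height phi_im.
Qed.
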